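(* Let $k \ge 3$ be an integer and $q \ge 3$ a prime power, both fixed, such that $\mathrm{char}(\mathbb F_q) \nmid k\binom{2k-1}{k-1}$. If $n$ is sufficiently large and $F$ is a monic polynomial in $\mathbb F_q[x]$ of degree $n$, then the interval $\mathcal I_q(F,h)$ contains a $k$-free polynomial for every integer $h \ge n/(2k)$.
   Context: $\mathbb F_q$ denotes the finite field with $q$ elements. For $F \in \mathbb F_q[x]$ and an integer $h$, $\mathcal I_q(F,h) = \{ Q \in \mathbb F_q[x] : \deg(F-Q) \le h\}$. A polynomial in $\mathbb F_q[x]$ is $k$-free if it is not divisible by the $k$th power of any non-constant polynomial. *)

(* Defs.v *)
From HB Require Import structures.
From mathcomp Require Import all_boot all_order all_algebra.

Set Implicit Arguments.
Unset Strict Implicit.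
Unset Printing Implicit Defensive.

Import Order.TTheory GRing.Theory Num.Theory.

Local Open Scope ring_scope.

(* The zero polynomial has degree -oo, so F itself lies in every interval,
   including those with h < 0. *)
Definition poly_interval (K : fieldType) (F : {poly K}) (h : int) :
    {pred {poly K}} :=
  [pred Q | (F - Q == 0) || ((size (F - Q)).-1%:Z <= h)].

Definition k_free (K : fieldType) (k : nat) (Q : {poly K}) : Prop :=
  forall D : {poly K}, (1 < size D)%N -> ~~ (D ^+ k %| Q)%R.

(* Main.v *)
Require Import Defs.
From HB Require Import structures.
From mathcomp Require Import all_boot all_order all_algebra.
From mathcomp Require Import qpoly qfpoly finfield zify ring.

Set Implicit Arguments.
Unset Strict Implicit.
Unset Printing Implicit Defensive.

Import Order.TTheory GRing.Theory Num.Theory.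

Local Open Scope ring_scope.

(* The polynomials of the interval divisible by P^k, for P monic irreducible
   of degree d, are counted and shown to be fewer than q^(h+1), in three ranges
   of d.
   If k d <= h, each P accounts for q^(h+1-kd) polynomials, and summing over
   all P of degree d converges fast enough.
   If h < k d, each P accounts for at most one polynomial; as long as d - h is
   bounded it suffices that there are at most q^d / d irreducibles.
   If d = h + t with t large, irreducibles P having a multiple of P^k in the
   interval repel each other.  Write u, v = u + a for two of them and
   x = m u^k, y = m' v^k for the multiples.  Expanding (u - v)^(2k-1) gives
   (-a)^(2k-1) = u^k B + v^k A with A, B forms of degree k - 1 in u and v, so
   (m A + m' B) u^k v^k = x (-a)^(2k-1) - (x - y) B u^k.
   When deg a is small the right side has degree < 2kd, hence vanishes, and m
   is a multiple w B of B.  A third such polynomial u + b gives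
   m = w B(u,a) = w' B(u,b), and comparing degrees in
   (w - w') B(u,a) = w' (B(u,b) - B(u,a)) is contradictory.  So a class of
   polynomials agreeing in their top coefficients contains at most two
   such P.  The hypothesis on the characteristic says that the first two
   coefficients of B(u,a), as a polynomial in a, do not vanish. *)

(* [pade k u a] is the form B(u,a) above, expanded in powers of [a]. *)
Definition pade_coef (R : nzRingType) (k i : nat) : R :=
  \sum_(j < k) (-1) ^+ j * ('C(k.*2.-1, j) * 'C(j, i))%:R.

Definition pade (R : comNzRingType) (k : nat) (u a : {poly R}) : {poly R} :=
  \sum_(i < k) pade_coef R k i *: (u ^+ (k.-1 - i) * a ^+ i).

(** * The Padé identity and the first two coefficients of the form *)

Section PadeRing.
Variable R : comNzRingType.
Implicit Types u a b : {poly R}.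

(** Expanding [(u + a) ^+ j] by the binomial theorem and exchanging the sums links the two shapes of
    the form: the one in [u] and [u + a] suits the identity below, the one in powers of [a] suits
    degree estimates. *)
Lemma padeE k u a :
  pade k u a =
  \sum_(j < k) ((-1) ^+ j * u ^+ (k.-1 - j) * (u + a) ^+ j) *+ 'C(k.*2.-1, j).
Proof.
rewrite /pade /pade_coef.
under eq_bigr => i _ do rewrite scaler_suml.
rewrite exchange_big; apply: eq_bigr => j _ /=.
rewrite exprDn mulr_sumr -sumrMnl.
rewrite [RHS](big_ord_widen k (fun i => ((-1) ^+ j * u ^+ (k.-1 - j) *
   (u ^+ (j - i) * a ^+ i *+ 'C(j, i))) *+ 'C(k.*2.-1, j))) ?ltn_ord //.
rewrite [RHS]big_mkcond; apply: eq_bigr => i _ /=.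
rewrite ltnS; case: leqP => [le_ij | lt_ji]; last first.
  by rewrite (bin_small lt_ji) muln0 mulr0 scale0r.
have -> : (k.-1 - i = (k.-1 - j) + (j - i))%N by have := ltn_ord j; lia.
rewrite -[LHS]mul_polyC rmorphM rmorphXn rmorphN1 rmorph_nat exprD.
rewrite -[_ *+ 'C(k.*2.-1, j)]mulr_natr -[_ *+ 'C(j, i)]mulr_natr natrM.
by ring.
Qed.

(** Write [- a = u - (u + a)] and cut the binomial expansion at index [k]: the terms before the cut
    contain [u ^+ k], the others [(u + a) ^+ k]. *)
Lemma pade_identity k u a :
  (0 < k)%N ->
  exists A, (- a) ^+ k.*2.-1 = u ^+ k * pade k u a + (u + a) ^+ k * A.
Proof.
move=> k_gt0; set M := k.*2.-1.
exists (\sum_(k <= j < M.+1)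
          ((-1) ^+ j * u ^+ (M - j) * (u + a) ^+ (j - k)) *+ 'C(M, j)).
have -> : - a = u - (u + a) by ring.
rewrite exprBn -(big_mkord xpredT
  (fun j => (-1) ^+ j * u ^+ (M - j) * (u + a) ^+ j *+ 'C(M, j))).
rewrite (@big_cat_nat _ _ _ k) //=; last by rewrite /M; lia.
rewrite padeE !mulr_sumr big_mkord; congr (_ + _).
  apply: eq_bigr => j _; rewrite -/M.
  have -> : (M - j = k + (k.-1 - j))%N by have := ltn_ord j; rewrite /M; lia.
  by rewrite exprD mulrnAr; congr (_ *+ _); ring.
rewrite big_nat [RHS]big_nat; apply: eq_bigr => j /andP[le_kj _].
have -> : (u + a) ^+ j = (u + a) ^+ k * (u + a) ^+ (j - k).
  by rewrite -exprD subnKC.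
by rewrite mulrnAr; congr (_ *+ _); ring.
Qed.

Lemma alt_sum_bin n m :
  \sum_(j < m.+1) (-1) ^+ j * 'C(n.+1, j)%:R = (-1) ^+ m * 'C(n, m)%:R :> R.
Proof.
elim: m => [|m IHm]; first by rewrite big_ord_recl big_ord0 !bin0 addr0.
by rewrite big_ord_recr /= IHm binS natrD exprS; ring.
Qed.

Lemma pade_coef0 k :
  pade_coef R k.+1 0 = (-1) ^+ k * 'C(k.*2, k)%:R.
Proof.
rewrite -alt_sum_bin /pade_coef; apply: eq_bigr => j _.
by rewrite bin0 muln1.
Qed.

(** Absorption, [(j + 1) C(n, j + 1) = n C(n - 1, j)], turns the weighted alternating sum into the
    one evaluated by [alt_sum_bin]. *)
Lemma pade_coef1 k :
  pade_coef R k.+2 1 =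
  - ((-1) ^+ k * ((k.*2.+3) * 'C(k.*2.+1, k))%:R).
Proof.
rewrite natrM mulrCA -alt_sum_bin mulr_sumr -sumrN.
rewrite /pade_coef -[k.+2.*2.-1]/(k.*2.+3) big_ord_recl.
rewrite bin0n muln0 mulr0 add0r; apply: eq_bigr => j _.
rewrite lift0 bin1 mulnC -mul_bin_diag natrM exprS.
by rewrite mulN1r !mulNr mulrCA.
Qed.

End PadeRing.

(** * Degrees of the Padé form and repulsion between close irreducibles *)

Section PadeSize.
Variable K : fieldType.
Implicit Types u v a b r x y : {poly K}.

Lemma size_sum_leq (I : Type) (l : seq I) (P : pred I) (E : I -> {poly K}) m :
  (forall i, P i -> (size (E i) <= m)%N) ->
  (size (\sum_(i <- l | P i) E i)%R <= m)%N.
Proof.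
move=> leEm; elim/big_ind: _ => // [|p1 p2 le1 le2].
  by rewrite size_poly0.
by rewrite (leq_trans (size_polyD _ _)) // geq_max le1.
Qed.

Lemma size_mul_leqS (p q : {poly K}) m n :
  (size p <= m.+1)%N -> (size q <= n.+1)%N -> (size (p * q)%R <= (m + n).+1)%N.
Proof.
move=> sp sq; apply: leq_trans (size_polyMleq _ _) _.
by rewrite -subn1 leq_subLR (leq_trans (leq_add sp sq)) // addSn addnS.
Qed.

Lemma size_mulX_leq u a d s i j :
  (size u <= d.+1)%N -> (size a <= s.+1)%N ->
  (size (u ^+ i * a ^+ j)%R <= (d * i + s * j).+1)%N.
Proof.
move=> su sa.
have := size_polyMleq (u ^+ i) (a ^+ j).
have := size_exp_leq u i; have := size_exp_leq a j.
have : ((size u).-1 * i <= d * i)%N by rewrite leq_mul2r; lia.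
have : ((size a).-1 * j <= s * j)%N by rewrite leq_mul2r; lia.
lia.
Qed.

Lemma size_expS u d m : size u = d.+1 -> size (u ^+ m) = (d * m).+1.
Proof.
move=> su; rewrite -[LHS]prednK ?size_exp ?su //.
by rewrite size_poly_gt0 expf_neq0 // -size_poly_eq0 su.
Qed.

Lemma size_addX (c : K) u r d m :
  size u = d.+1 -> c != 0 -> (size r <= d * m)%N ->
  size (c *: u ^+ m + r) = (d * m).+1.
Proof.
move=> su c_neq0 sr.
have sc : size (c *: u ^+ m) = (d * m).+1 by rewrite size_scale ?(size_expS _ su).
by rewrite size_polyDl sc.
Qed.

(** Modulo [a] only the term in [u ^+ k] survives; coprimality of the form with [a] will follow from
    this. *)
Lemma pade_lead k u a :
  exists r, pade k.+1 u a = pade_coef K k.+1 0 *: u ^+ k + a * r.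
Proof.
rewrite /pade big_ord_recl /= subn0 expr0 mulr1.
exists (\sum_(i < k) pade_coef K k.+1 (lift ord0 i) *:
   (u ^+ (k - lift ord0 i) * a ^+ i)).
congr (_ + _); rewrite mulr_sumr; apply: eq_bigr => i _.
by rewrite -scalerAr /= /bump add1n exprS mulrCA.
Qed.

(** As [deg a < deg u], each factor [u] traded for [a] lowers the degree, so the term free of [a]
    dominates. *)
Lemma size_pade k u a d :
  size u = d.+1 -> (size a <= d)%N -> pade_coef K k.+1 0 != 0 ->
  size (pade k.+1 u a) = (d * k).+1.
Proof.
move=> su sa c0; rewrite /pade big_ord_recl /= subn0 expr0 mulr1.
apply: size_addX => //; apply: size_sum_leq => i _.
rewrite (leq_trans (size_scale_leq _ _)) //= /bump add1n.
have lt_ik := ltn_ord i.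
case: d su sa => [|d] su sa.
  by move: sa; rewrite leqn0 size_poly_eq0 => /eqP->; rewrite expr0n mulr0 size_poly0.
have := @size_mulX_leq u a d.+1 d (k - i.+1) i.+1.
rewrite su => /(_ (leqnn _) sa) /leq_trans -> //.
have -> : (d.+1 * k = d.+1 * (k - i.+1) + d.+1 * i.+1)%N by rewrite -mulnDr; congr muln; lia.
by rewrite ltn_add2l ltn_mul2r ltnSn.
Qed.

(** The terms free of [a] and [b] cancel, the linear ones give the dominant cofactor [u ^+ k], and
    in the others [b ^+ i - a ^+ i] leaves a cofactor of smaller degree. *)
Lemma size_pade_sub k u a b d :
  size u = d.+1 -> (size a <= d)%N -> (size b <= d)%N ->
  pade_coef K k.+2 1 != 0 ->
  exists2 r, pade k.+2 u b - pade k.+2 u a = (b - a) * r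
           & size r = (d * k).+1.
Proof.
move=> su sa sb c1.
exists (pade_coef K k.+2 1 *: u ^+ k + \sum_(i < k) pade_coef K k.+2 i.+2 *:
   (u ^+ (k - i.+1) * \sum_(j < i.+2) b ^+ (i.+1 - j) * a ^+ j)).
  rewrite /pade -sumrB !big_ord_recl /= !expr0 subrr add0r.
  rewrite /bump !add1n !expr1 subSS subn0 -scalerBr -mulrBr [RHS]mulrDr.
  congr (_ + _); first by rewrite -scalerAr mulrC.
  rewrite mulr_sumr; apply: eq_bigr => i _.
  by rewrite /bump !add1n -scalerBr -mulrBr subrXX -scalerAr mulrCA subSS.
apply: size_addX => //; apply: size_sum_leq => i _.
rewrite (leq_trans (size_scale_leq _ _)) //=.
have lt_ik := ltn_ord i.
rewrite mulr_sumr; apply: size_sum_leq => j _.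
have le_j := ltn_ord j.
case: d su sa sb => [|d] su sa sb.
  move: sa sb; rewrite !leqn0 !size_poly_eq0 => /eqP-> /eqP->.
  by rewrite -exprD subnK ?expr0n ?mulr0 ?size_poly0.
have s1 := @size_mulX_leq b a d d (i.+1 - j) j sb sa.
have s2 : (size (u ^+ (k - i.+1))%R <= (d.+1 * (k - i.+1)).+1)%N.
  by have := size_exp_leq u (k - i.+1); rewrite su.
have := size_polyMleq (u ^+ (k - i.+1)) (b ^+ (i.+1 - j) * a ^+ j).
have -> : (d.+1 * k = d.+1 * (k - i.+1) + d.+1 * i.+1)%N by rewrite -mulnDr; congr muln; lia.
have : (d * (i.+1 - j) + d * j = d * i.+1)%N by rewrite -mulnDr; congr muln; lia.
have : (d * i.+1 < d.+1 * i.+1)%N by rewrite ltn_mul2r ltnSn.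
lia.
Qed.

(* A nonzero multiple of [(u v)^k] is too large, so the Pade combination of
   the two cofactors vanishes. *)
Lemma close_powers_cofactor k u v x y n h d s :
  size u = d.+1 -> size v = d.+1 -> coprimep u v ->
  (size (v - u)%R <= s.+1)%N ->
  size x = n.+1 -> (size (x - y)%R <= h.+1)%N -> (h < d)%N ->
  (n + k.*2.+1 * s < k.+1.*2 * d)%N -> (s < d)%N -> pade_coef K k.+1 0 != 0 ->
  u ^+ k.+1 %| x -> v ^+ k.+1 %| y ->
  exists w, x = w * pade k.+1 u (v - u) * u ^+ k.+1.
Proof.
move=> su sv cop sa sx sxy lt_hd lt_n lt_sd c0 /dvdpP[m1 xE] /dvdpP[m2 yE].
set a := v - u in sa *; set B := pade k.+1 u a.
have u0 : u != 0 by rewrite -size_poly_eq0 su.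
have v0 : v != 0 by rewrite -size_poly_eq0 sv.
have vE : u + a = v by rewrite /a; ring.
have [A AE] := @pade_identity _ k.+1 u a isT.
rewrite vE -/B in AE.
have key : (m1 * A + m2 * B) * (u ^+ k.+1 * v ^+ k.+1) =
           x * (- a) ^+ k.+1.*2.-1 - (x - y) * (B * u ^+ k.+1).
  by rewrite AE xE yE; ring.
have sB : size B = (d * k).+1 by apply: size_pade => //; lia.
have suk := size_expS k.+1 su.
have svk := size_expS k.+1 sv.
(* The two terms have degrees at most [n + (2k+1)s] and [h + dk + d(k+1)], both below [2d(k+1)], the
   degree of [u ^+ k.+1 * v ^+ k.+1]. *)
have small : (size (x * (- a) ^+ k.+1.*2.-1 - (x - y) * (B * u ^+ k.+1))%R <= (d * k.+1).*2)%N.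
  rewrite (leq_trans (size_polyD _ _)) // size_polyN geq_max; apply/andP; split.
    have saM : (size ((- a) ^+ k.+1.*2.-1)%R <= (k.*2.+1 * s).+1)%N.
      rewrite (leq_trans (size_exp_leq _ _)) // size_polyN ltnS mulnC leq_mul2l.
      by case: (size a) sa => // m; rewrite ltnS => ->; rewrite orbT.
    apply: leq_trans (size_mul_leqS (eq_leq sx) saM) _.
    by rewrite doubleMr (mulnC d).
  apply: leq_trans (size_mul_leqS sxy (size_mul_leqS (eq_leq sB) (eq_leq suk))) _.
  by rewrite !mulnS; lia.
have z : m1 * A + m2 * B = 0.
  apply/eqP; apply: contraTT small => nz; rewrite -key -ltnNge.
  rewrite size_mul ?mulf_neq0 ?expf_neq0 // size_mul ?expf_neq0 // suk svk.
  by move: nz; rewrite -size_poly_gt0; move: (size _) => m; lia.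
(* The right side of [key] now vanishes; cancelling [u ^+ k.+1] leaves
   [m1 * (- a) ^+ k.+1.*2.-1 = (x - y) * B], and [B] is coprime to [a], hence divides [m1]. *)
have /eqP := key; rewrite z mul0r eq_sym subr_eq0 => /eqP; rewrite xE mulrAC.
rewrite mulrA => /mulIf => /(_ (expf_neq0 _ u0)) E1.
have copBa : coprimep B (a ^+ k.+1.*2.-1).
  rewrite coprimep_expr //.
  have [r] := @pade_lead k u a; rewrite -/B => ->.
  rewrite addrC coprimep_sym mulrC coprimep_addl_mul coprimepZr //.
  by rewrite coprimep_expr // coprimep_sym /a -[v - u](addrC) -mulN1r coprimep_addl_mul.
have /dvdpP[w wE] : B %| m1.
  rewrite -(Gauss_dvdpl _ copBa) -[X in _ %| _ * X]opprK -[- - _]mulN1r.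
  have -> : m1 * (-1 * - a ^+ k.+1.*2.-1) = - (m1 * (- a) ^+ k.+1.*2.-1).
    by rewrite exprNn -signr_odd /= odd_double expr1; ring.
  by rewrite E1 dvdpNr dvdp_mull.
by exists w; rewrite wE.
Qed.

(** The pairs (1,2) and (1,3) give two factorizations of [x1]. Their comparison forces
    [deg w3 + deg (b - a) >= d], whereas [deg w3 = n - (2k+3)d] and [deg (b - a) <= s], against the
    bound on [n]. *)
Lemma no_three_close_powers k (u1 u2 u3 x1 x2 x3 : {poly K}) n h d s :
  pade_coef K k.+2 0 != 0 -> pade_coef K k.+2 1 != 0 ->
  size u1 = d.+1 -> size u2 = d.+1 -> size u3 = d.+1 ->
  coprimep u1 u2 -> coprimep u1 u3 -> u2 != u3 ->
  (size (u2 - u1)%R <= s.+1)%N -> (size (u3 - u1)%R <= s.+1)%N ->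
  size x1 = n.+1 -> (size (x1 - x2)%R <= h.+1)%N -> (size (x1 - x3)%R <= h.+1)%N ->
  (h < d)%N -> (n + k.+1.*2.+1 * s < k.+2.*2 * d)%N ->
  (s < d)%N ->
  u1 ^+ k.+2 %| x1 -> u2 ^+ k.+2 %| x2 -> u3 ^+ k.+2 %| x3 -> False.
Proof.
move=> c0 c1 su1 su2 su3 cop12 cop13 neq23 sa sb sx sx2 sx3 lt_hd lt_n lt_sd d1 d2 d3.
have [w2 E2] := close_powers_cofactor su1 su2 cop12 sa sx sx2 lt_hd lt_n lt_sd c0 d1 d2.
have [w3 E3] := close_powers_cofactor su1 su3 cop13 sb sx sx3 lt_hd lt_n lt_sd c0 d1 d3.
set a := u2 - u1 in sa E2; set b := u3 - u1 in sb E3.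
have u0 : u1 != 0 by rewrite -size_poly_eq0 su1.
have x0 : x1 != 0 by rewrite -size_poly_eq0 sx.
have sa' : (size a <= d)%N by lia.
have sb' : (size b <= d)%N by lia.
have sBa := size_pade su1 sa' c0.
have sBb := size_pade su1 sb' c0.
have [r rE sr] := size_pade_sub su1 sa' sb' c1.
have suk := size_expS k.+2 su1.
have w30 : w3 != 0 by apply: contraNneq x0 => w30; rewrite E3 w30 !mul0r.
have sw3 : (size w3 + d * k.+1 + d * k.+2 = n.+1)%N.
  have B0 : pade k.+2 u1 b != 0 by rewrite -size_poly_eq0 sBb.
  rewrite -sx E3 size_mul ?expf_neq0 ?mulf_neq0 // suk size_mul // sBb.
  by rewrite !addnS.
have /mulIf : u1 ^+ k.+2 != 0 by rewrite expf_neq0.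
move=> /(_ (w2 * pade k.+2 u1 a) (w3 * pade k.+2 u1 b)); rewrite -E2 -E3 => /(_ erefl) E.
have key : (w2 - w3) * pade k.+2 u1 a = w3 * ((b - a) * r).
  by rewrite -rE mulrBl E; ring.
have ba0 : b - a != 0 by rewrite /a /b opprB addrA subrK subr_eq0 eq_sym.
have sba : (size (b - a)%R <= s.+1)%N.
  by rewrite (leq_trans (size_polyD _ _)) // size_polyN geq_max sa sb.
have r0 : r != 0 by rewrite -size_poly_eq0 sr.
have rhs0 : w3 * ((b - a) * r) != 0 by rewrite !mulf_neq0.
have Ba0 : pade k.+2 u1 a != 0 by rewrite -size_poly_eq0 sBa.
have w23 : w2 - w3 != 0 by apply: contraNneq rhs0 => w23; rewrite -key w23 mul0r.
have := congr1 (fun p : {poly K} => size p) key => /=.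
rewrite size_mul // sBa size_mul ?mulf_neq0 // size_mul // sr.
rewrite -size_poly_gt0 in w30; rewrite -size_poly_gt0 in w23.
rewrite -size_poly_gt0 in ba0.
move: (size (w2 - w3)) (size (b - a)) (size w3) w30 sw3 w23 ba0 sba.
move=> z1 z2 z3 z3_gt0 sw3 z1_gt0 z2_gt0 le_z2.
have le_s : (s <= k.+1.*2.+1 * s)%N by rewrite leq_pmull.
have dkE : (k.+2.*2 * d = (d * k).*2 + 4 * d)%N by rewrite -!muln2; ring.
move: lt_n sw3; rewrite dkE !mulnS; move: (_ * s)%N le_s (d * k)%N.
by clear -z3_gt0 z1_gt0 z2_gt0 le_z2; lia.
Qed.
End PadeSize.

(** With [k = r + 2], [k C(2k-1, k-1) = (2k-1) C(2k-2, k-1)] and [C(2k-2, k-1) = 2 C(2k-3, k-2)], so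
    up to sign both coefficients are images of divisors of the number that [p] does not divide. *)
Lemma pade_coef_neq0 (K : fieldType) (p r : nat) :
  p \in [pchar K] -> ~~ (p %| r.+2 * 'C(r.*2.+3, r.+1))%N ->
  pade_coef K r.+2 0 != 0 /\ pade_coef K r.+2 1 != 0.
Proof.
move=> pK.
have -> : (r.+2 * 'C(r.*2.+3, r.+1) = r.*2.+3 * 'C(r.*2.+2, r.+1))%N.
  by rewrite mul_bin_down; congr (_ * _)%N; lia.
have Ebin : ('C(r.*2.+2, r.+1) = 2 * 'C(r.*2.+1, r))%N.
  rewrite binS; have -> : 'C(r.*2.+1, r.+1) = 'C(r.*2.+1, r).
    by rewrite -bin_sub; [congr binomial |]; lia.
  by rewrite mul2n addnn.
move=> ndiv; split.
  rewrite (pade_coef0 K r.+1) mulf_neq0 ?signr_eq0 // -(dvdn_pcharf pK).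
  by apply: contra ndiv; apply: dvdn_mull.
rewrite pade_coef1 oppr_eq0 mulf_neq0 ?signr_eq0 // -(dvdn_pcharf pK).
by apply: contra ndiv; rewrite Ebin mulnCA; apply: dvdn_mull.
Qed.

(** * Counting irreducibles and their multiples in the interval *)

Section Counting.
Variable K : finFieldType.
Local Notation q := #|K|.

(** The quotient by [P] is a field with [q ^ d] elements, so the class of ['X] is fixed by the power
    [q ^ d]. *)
Lemma irreducible_dvd_Xcard (P : {poly K}) d :
  irreducible_poly P -> P \is monic -> size P = d.+1 -> P %| 'X^(q ^ d) - 'X.
Proof.
move=> irrP monP sP; pose mi : monic_irreducible_poly P := (irrP, monP).
have qXE : in_qpoly P ('X^(q ^ d) - 'X) = 0.
  rewrite rmorphB rmorphXn /=; have := expf_card ('qX : {poly %/ P with mi}).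
  by rewrite card_qfpoly sP /= => ->; rewrite subrr.
rewrite Pdiv.Idomain.dvdpE /Pdiv.Ring.rdvdp -(mk_monicE mi).
exact/eqP/(congr1 (@polyn _ _) qXE).
Qed.

Lemma prod_dvdp (s : seq {poly K}) (Q : {poly K}) :
  uniq s -> {in s &, forall P P', P != P' -> coprimep P P'} ->
  {in s, forall P, P %| Q} -> \prod_(P <- s) P %| Q.
Proof.
elim: s => [|P s IHs] /=; first by rewrite big_nil dvd1p.
case/andP=> Ps us cop dvdQ; rewrite big_cons Gauss_dvdp.
  rewrite dvdQ ?mem_head // IHs // => [P1 P2 s1 s2|P1 s1].
    by apply: cop; rewrite inE ?s1 ?s2 orbT.
  by apply: dvdQ; rewrite inE s1 orbT.
rewrite big_seq; elim/big_ind: _ => [|A B cA cB|P1 s1].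
- by rewrite coprimep1.
- by rewrite coprimepMr cA cB.
by apply: cop; rewrite ?mem_head ?inE ?s1 ?orbT //; apply: contraNneq Ps => ->.
Qed.

Definition monic_irr d : {set {poly_(d.+1) K}} :=
  [set P : {poly_(d.+1) K} |
    [&& (P : {poly K}) \is monic, size P == d.+1 & irreducibleb P]].

Lemma monic_irrP d (P : {poly_(d.+1) K}) :
  reflect [/\ (P : {poly K}) \is monic, size P = d.+1 & irreducible_poly P]
          (P \in monic_irr d).
Proof.
by rewrite inE; apply: (iffP and3P) => -[? /eqP ? /irreducibleP ?].
Qed.

Lemma monic_irr_coprime d (P P' : {poly_(d.+1) K}) :
  P \in monic_irr d -> P' \in monic_irr d -> P != P' -> coprimep P P'.
Proof.
move=> /monic_irrP[mP sP iP] /monic_irrP[mP' sP' iP'] neqPP'.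
rewrite irreducible_poly_coprime //; apply: contra neqPP' => dvdPP'.
apply/eqP/val_inj/eqP => /=; rewrite -eqp_monic // -dvdp_size_eqp //.
by rewrite sP sP'.
Qed.

(** These irreducibles are pairwise coprime, so their product divides ['X^(q ^ d) - 'X]; compare
    degrees. *)
Lemma card_monic_irr d : (0 < d)%N -> (d * #|monic_irr d| <= q ^ d)%N.
Proof.
move=> d_gt0; pose s := [seq val P | P <- enum (monic_irr d)].
have qd_gt1 : (1 < q ^ d)%N by rewrite -(exp1n d) ltn_exp2r // card_finNzRing_gt1.
have sX : size ('X^(q ^ d) - 'X : {poly K}) = (q ^ d).+1.
  by rewrite size_polyDl ?size_polyXn // size_polyN size_polyX.
have X0 : 'X^(q ^ d) - 'X != 0 :> {poly K} by rewrite -size_poly_eq0 sX.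
have dvds : \prod_(P <- s) P %| 'X^(q ^ d) - 'X.
  apply: prod_dvdp.
  - by rewrite map_inj_uniq ?enum_uniq //; apply: val_inj.
  - move=> _ _ /mapP[P + ->] /mapP[P' + ->]; rewrite !mem_enum => iP iP' neq.
    by apply: monic_irr_coprime => //; apply: contraNneq neq => ->.
  move=> _ /mapP[P + ->]; rewrite mem_enum => /monic_irrP[? ? ?].
  exact: irreducible_dvd_Xcard.
have := dvdp_leq X0 dvds; rewrite sX big_map big_enum.
have -> : (size (\prod_(P in monic_irr d) (P : {poly K}))%R = (d * #|monic_irr d|).+1)%N.
  rewrite size_prod => [|P /monic_irrP[/monic_neq0]] //.
  rewrite (eq_bigr (fun=> d.+1)) => [|P /monic_irrP[]] //.
  by rewrite sum_nat_const mulnS -addnS addKn mulnC.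
by [].
Qed.

(** The interval is parametrized by shifts [E] of degree at most [h], which form a finite type. *)
Definition short_multiples k h (F P : {poly K}) : {set {poly_(h.+1) K}} :=
  [set E : {poly_(h.+1) K} | P ^+ k %| F + E].

(** Two such shifts differ by a multiple of [P ^+ k], so the coefficients from index [k * d] on
    determine the shift. For [k * d > h] the truncated subtraction makes the bound 1. *)
Lemma card_short_multiples k h d (F P : {poly K}) :
  size P = d.+1 -> (#|short_multiples k h F P| <= q ^ (h.+1 - k * d))%N.
Proof.
move=> sP; pose f (E : {poly_(h.+1) K}) := npolyp (h.+1 - k * d) (drop_poly (k * d) E).
rewrite -card_npoly -[X in (X <= _)%N](card_in_imset (f := f)).
  exact: max_card.
move=> E1 E2; rewrite !inE => dvd1 dvd2.
move=> /(congr1 (fun E : {poly_ _ K} => E : {poly K})) /=.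
rewrite !npolypK; try by rewrite size_drop_poly leq_sub2r.
move=> eqd; apply/val_inj/eqP; rewrite -subr_eq0 -size_poly_leq0 leqNgt.
apply/negP; rewrite size_poly_gt0 => nz; have := dvdp_sub dvd1 dvd2.
have -> : F + E1 - (F + E2) = val E1 - val E2 by rewrite /=; ring.
move=> /(dvdp_leq nz); rewrite leqNgt => /negP; apply.
have -> : size (P ^+ k) = (k * d).+1.
  by rewrite (size_expS _ sP) mulnC.
rewrite ltnS; apply/leq_sizeP => j lekj; rewrite coefB.
have := congr1 (fun p : {poly K} => p`_(j - k * d)) eqd.
by rewrite !coef_drop_poly subnK // => ->; rewrite subrr.
Qed.

(** Pigeonhole on the coefficients of indices [s] to [d - 1]: elements of one class differ by a
    polynomial of size at most [s]. *)
Lemma card_close_le (T : finType) (A : {set T}) d s (f : T -> {poly K}) m :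
  (forall x, x \in A -> f x \is monic /\ size (f x) = d.+1) ->
  (s <= d)%N ->
  (forall B : {set T}, B \subset A ->
     {in B &, forall x y, (size (f x - f y)%R <= s)%N} -> (#|B| <= m)%N) ->
  (#|A| <= m * q ^ (d - s))%N.
Proof.
move=> fA le_sd small.
(* Removing the common leading term ['X^d] leaves [d - s] coefficients to record. *)
pose g (x : T) := npolyp (d - s) (drop_poly s (f x - 'X^d)).
rewrite -sum1_card (partition_big g xpredT) //=.
rewrite mulnC -card_npoly -sum_nat_const leq_sum // => y _.
rewrite sum1_card -cardsE small //; first by apply/subsetP=> x; rewrite inE => /andP[].
move=> x1 x2; rewrite !inE => /andP[A1 /eqP g1] /andP[A2 /eqP g2].
have gK x : x \in A -> (g x : {poly K}) = drop_poly s (f x - 'X^d).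
  move=> /fA[mf sf]; rewrite npolypK // size_drop_poly leq_sub2r //.
  apply/leq_sizeP => j; rewrite leq_eqVlt coefB coefXn => /predU1P[<-|lt_dj].
    by rewrite eqxx; move: mf; rewrite monicE lead_coefE sf => /eqP->; rewrite subrr.
  by rewrite nth_default ?sf // gtn_eqF // subr0.
apply/leq_sizeP => j le_sj; have := congr1 (fun p : {poly K} => p`_(j - s))
  (etrans (esym (gK _ A1)) (etrans (congr1 (@polyn _ _) (etrans g1 (esym g2))) (gK _ A2))).
rewrite !coef_drop_poly subnK // !coefB => /addIr ->; exact: subrr.
Qed.

Lemma card_large_irr r h n d s (F : {poly K}) :
  pade_coef K r.+2 0 != 0 -> pade_coef K r.+2 1 != 0 ->
  size F = n.+1 -> (h < n)%N -> (h < d)%N -> (s < d)%N ->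
  (n + r.+1.*2.+1 * s < r.+2.*2 * d)%N ->
  (#|[set P in monic_irr d | short_multiples r.+2 h F P != set0]|
     <= 2 * q ^ (d - s.+1))%N.
Proof.
move=> c0 c1 sF lt_hn lt_hd lt_sd lt_n.
apply: (card_close_le (f := fun P : {poly_(d.+1) K} => P : {poly K})) => //.
  by move=> P; rewrite inE => /andP[/monic_irrP[]].
move=> B /subsetP subB closeB; rewrite leqNgt; apply/negP.
case/card_gt2P => P1 [P2] [P3] [[B1 B2 B3] [neq12 neq23 neq31]].
have ex P : P \in B -> exists E : {poly_(h.+1) K}, (P : {poly K}) ^+ r.+2 %| F + E.
  by move/subB; rewrite inE => /andP[_ /set0Pn[E]]; rewrite inE => ?; exists E.
have irrB P : P \in B -> P \in monic_irr d by move/subB; rewrite inE => /andP[].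
have [[E1 D1] [E2 D2] [E3 D3]] := And3 (ex _ B1) (ex _ B2) (ex _ B3).
have sz P : P \in B -> size P = d.+1 by move/irrB/monic_irrP=> [].
have diffE (E E' : {poly_(h.+1) K}) : (size ((F + E) - (F + E'))%R <= h.+1)%N.
  have -> : F + E - (F + E') = polyn (E - E') by rewrite /=; ring.
  exact: size_npoly.
apply: (no_three_close_powers c0 c1 (sz _ B1) (sz _ B2) (sz _ B3) _ _ _ _ _ _
          (diffE E1 E2) (diffE E1 E3) lt_hd lt_n lt_sd D1 D2 D3).
- by apply: monic_irr_coprime; rewrite ?irrB.
- by apply: monic_irr_coprime; rewrite ?irrB // eq_sym.
- by apply: contraNneq neq23 => /val_inj->.
- exact: closeB.
- exact: closeB.
by rewrite size_polyDl sF // (leq_ltn_trans (size_npoly _)).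
Qed.

End Counting.

(** * Numerical estimates for the three ranges of degrees *)

Section GeometricBounds.
Local Open Scope nat_scope.
Variable q : nat.
Hypothesis q_gt1 : 1 < q.

Lemma sum_expn_lt m : \sum_(0 <= d < m) q ^ d < q ^ m.
Proof.
elim: m => [|m IHm]; first by rewrite big_geq.
rewrite big_nat_recr //= expnS; apply: leq_trans (leq_mul q_gt1 (leqnn _)).
by rewrite mul2n -addnn -addSn leq_add2r.
Qed.

Lemma sum_expn_sub_lt h a b :
  a <= b -> b <= h.+1 -> \sum_(a <= d < b) q ^ (h - d) < q ^ (h.+1 - a).
Proof.
move=> le_ab le_bh.
(* The extra summand [q ^ (h.+1 - b)] makes the induction on [b] close: it absorbs the next term
   because [q >= 2]. *)
suff: \sum_(a <= d < b) q ^ (h - d) + q ^ (h.+1 - b) <= q ^ (h.+1 - a).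
  by apply: leq_trans; rewrite -addn1 leq_add2l expn_gt0 ltnW.
elim: b le_ab le_bh => [|b IHb].
  by rewrite leqn0 => /eqP-> _; rewrite big_geq.
rewrite leq_eqVlt => /predU1P[<- _|]; first by rewrite big_geq.
rewrite ltnS => le_ab le_bh; apply: leq_trans (IHb le_ab (ltnW le_bh)).
rewrite big_nat_recr //= -addnA leq_add2l subSS addnn -mul2n subSn //.
by rewrite expnS leq_mul2r q_gt1 orbT.
Qed.

Lemma sum_nat_divn M (f : nat -> nat) a b :
  0 < M -> a <= b ->
  \sum_(M * a <= t < M * b) f (t %/ M) = M * \sum_(a <= r < b) f r.
Proof.
move=> M_gt0; elim: b => [|b IHb].
  by rewrite leqn0 => /eqP->; rewrite !big_geq ?muln0.
rewrite leq_eqVlt => /predU1P[<-|]; first by rewrite !big_geq ?muln0.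
rewrite ltnS => le_ab; rewrite big_nat_recr //= mulnDr -IHb //.
rewrite (@big_cat_nat _ _ _ (M * b)) ?leq_mul2l ?le_ab ?leqnSn ?orbT //=.
congr (_ + _); rewrite -[M * b in LHS]add0n mulnS big_addn addnK.
rewrite big_nat (eq_bigr (fun=> f b)) => [|t /andP[_ lt_tM]].
  by rewrite -big_nat sum_nat_const_nat subn0.
by rewrite addnC mulnC divnMDl // divn_small // addn0.
Qed.

(* The three ranges are [k d <= h], [h < k d] with [d < h + T], and
   [h + T <= d]; each contributes at most [q ^ h]. *)
Lemma sum_three_ranges_lt k h (b : nat -> nat) :
  let M := k.*2.-1 in let T := M * M.*2.+1 in
  2 < q -> 2 < k -> k * q ^ T <= h ->
  (forall d, 0 < d -> b d <= q ^ d * q ^ (h.+1 - k * d)) ->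
  (forall d, h < k * d -> d * b d <= q ^ d) ->
  (forall t, 0 < t <= h -> b (h + t) <= 2 * q ^ (h - t %/ M)) ->
  \sum_(1 <= d < h.*2.+1) b d < q ^ h.+1.
Proof.
move=> M T q_gt2 k_gt2 le_h bA bB bC.
have q_gt0 : 0 < q by exact: ltnW.
have M_gt0 : 0 < M by rewrite /M; lia.
have le_Th : T <= h.
  apply: leq_trans (ltnW (ltn_expl T q_gt1)) (leq_trans _ le_h).
  by rewrite leq_pmull //; lia.
have R_leT : M.*2.+1 <= T by rewrite leq_pmull.
have kh : h %/ k <= h by exact: leq_div.
rewrite (@big_cat_nat _ _ _ (h %/ k).+1) //=; last first.
  by rewrite ltnS -addnn (leq_trans kh) ?leq_addr.
rewrite (@big_cat_nat _ _ _ (h + T) (h %/ k).+1) /=; first last.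
- by rewrite -addnn -addnS leq_add2l (leq_trans le_Th).
- by rewrite -addn1 leq_add // /T muln_gt0 M_gt0.
(* Since [k >= 3], [d + (h + 1 - kd) <= h - d] for [d >= 1], which leaves a geometric sum. *)
have A : \sum_(1 <= d < (h %/ k).+1) b d < q ^ h.
  have := @sum_expn_sub_lt h 1 (h %/ k).+1 isT kh; rewrite subn1.
  apply: leq_ltn_trans.
  rewrite big_nat [X in _ <= X]big_nat; apply: leq_sum => d /andP[d_gt0 le_d].
  rewrite (leq_trans (bA d d_gt0)) // -expnD leq_pexp2l //.
  have : k * d <= h by rewrite mulnC -leq_divRL //; lia.
  have : 3 * d <= k * d by rewrite leq_mul2r k_gt2 orbT.
  by lia.
(* Multiply by [k * q ^ T <= h]: as [h < k * d] here, [h * b d <= k * (d * b d) <= k * q ^ d], and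
   these sum to at most [k * q ^ (h + T)]. *)
have B : \sum_((h %/ k).+1 <= d < h + T) b d <= q ^ h.
  have kqT_gt0 : 0 < k * q ^ T by rewrite muln_gt0 expn_gt0 q_gt0 andbT; lia.
  rewrite -(leq_pmul2l kqT_gt0) -[X in _ <= X]mulnA -expnD (addnC T).
  apply: leq_trans (leq_mul le_h (leqnn _)) _.
  rewrite big_distrr /=.
  have := ltnW (sum_expn_lt (h + T)); rewrite -(leq_pmul2l (_ : 0 < k)); last by lia.
  apply: leq_trans; rewrite [X in _ <= k * X](@big_cat_nat _ _ _ (h %/ k).+1) //=; last first.
    by rewrite -addn1 leq_add // /T muln_gt0 M_gt0.
  rewrite mulnDr (leq_trans _ (leq_addl _ _)) // big_distrr /=.
  rewrite big_nat [X in _ <= X]big_nat; apply: leq_sum => d /andP[lt_d _].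
  have lt_hkd : h < k * d by rewrite mulnC -ltn_divLR //; lia.
  rewrite (leq_trans _ (leq_mul (leqnn k) (bB d lt_hkd))) // mulnA.
  by rewrite leq_mul2r (ltnW lt_hkd) orbT.
(* Grouping [t = d - h] by [t %/ M] gives blocks of length [M]. As [T = M * (2M + 1)], the first
   block has index [2M + 1], so the sum is at most [2M * q ^ (h - 2M)], and [2M < q ^ (2M)]. *)
have C : \sum_(h + T <= d < h.*2.+1) b d <= q ^ h.
  rewrite addnC big_addn -addnn -addnS addKn.
  have le1 : \sum_(T <= t < h.+1) b (t + h) <= 2 * \sum_(T <= t < h.+1) q ^ (h - t %/ M).
    rewrite big_distrr /= big_nat [X in _ <= X]big_nat.
    apply: leq_sum => t /andP[le_Tt lt_th]; rewrite addnC bC //.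
    rewrite ltnS in lt_th.
    by rewrite lt_th andbT (leq_trans _ le_Tt) // /T muln_gt0 M_gt0.
  apply: leq_trans le1 _.
  (* The range is lengthened to a multiple of [M] so that all blocks are full. *)
  have le2 : \sum_(T <= t < h.+1) q ^ (h - t %/ M) <=
             \sum_(T <= t < M * h.+1) q ^ (h - t %/ M).
    by rewrite (@big_cat_nat _ _ _ h.+1 T (M * h.+1)) ?leq_pmull ?(leqW le_Th) ?leq_addr.
  apply: leq_trans (leq_mul (leqnn 2) le2) _.
  have le_Rh : M.*2.+1 <= h.+1 by rewrite (leq_trans R_leT) // leqW.
  rewrite /T (@sum_nat_divn M (fun r => q ^ (h - r))) // mulnA mul2n.
  apply: leq_trans (leq_mul (leqnn _) (ltnW (sum_expn_sub_lt le_Rh (leqnn _)))) _.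
  rewrite subSS -[h in X in _ <= X](@subnKC M.*2 h) ?expnD //.
  by rewrite leq_mul2r (ltnW (ltn_expl _ _)) ?orbT.
rewrite expnS; apply: leq_trans (leq_mul q_gt2 (leqnn _)).
by lia.
Qed.
End GeometricBounds.

Lemma card_bigcup_leq (I T : finType) (P : pred I) (A : I -> {set T}) :
  (#|\bigcup_(i | P i) A i| <= \sum_(i | P i) #|A i|)%N.
Proof.
elim/big_rec2: _ => [|i m B _ le_B]; first by rewrite cards0.
by rewrite (leq_trans (leq_card_setU _ _)) // leq_add2l.
Qed.

(** * From the counts to a shift outside all bad sets *)

Section KFreeShifts.
Variable K : finFieldType.
Local Notation q := #|K|.

Lemma exists_monic_irr_dvdp (D : {poly K}) : (1 < size D)%N ->
  exists P : {poly K}, [/\ P \is monic, irreducible_poly P & P %| D].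
Proof.
have [m] := ubnP (size D); elim: m D => // m IHm D; rewrite ltnS => sD D_gt1.
have D0 : D != 0 by rewrite -size_poly_gt0 ltnW.
have [irrD|] := boolP (irreducibleb D).
  have lc0 : (lead_coef D)^-1 != 0 by rewrite invr_eq0 lead_coef_eq0.
  exists ((lead_coef D)^-1 *: D); split.
  - by rewrite monicE lead_coefZ mulVf // lead_coef_eq0.
  - move/irreducibleP: irrD => [_ irrD]; split; first by rewrite size_scale.
    move=> Q sQ; rewrite dvdpZr // => /(irrD _ sQ) /eqp_trans; apply.
    by rewrite eqp_sym eqp_scale.
  by rewrite dvdpZl.
rewrite /irreducibleb D_gt1 /= negb_forall => /existsP[Q].
rewrite negb_imply -ltnNge -Pdiv.Idomain.dvdpE => /andP[dvdQ Q_gt1].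
have sQ : (size Q < m)%N.
  by apply: leq_ltn_trans (size_npoly Q) _; rewrite prednK // ltnW.
have [P [mP iP dP]] := IHm Q sQ Q_gt1.
by exists P; split=> //; apply: dvdp_trans dvdQ.
Qed.

Definition bad_shifts k h (F : {poly K}) d : {set {poly_(h.+1) K}} :=
  \bigcup_(P in monic_irr K d) short_multiples k h F P.

(** Union bound in which only the irreducibles having a multiple of their [k]-th power in the
    interval count. *)
Lemma card_bad_shifts k h (F : {poly K}) d :
  (#|bad_shifts k h F d| <=
   #|[set P in monic_irr K d | short_multiples k h F P != set0]| *
   q ^ (h.+1 - k * d))%N.
Proof.
rewrite -sum_nat_const /bad_shifts (bigID (fun P : {poly_(d.+1) K} =>
  short_multiples k h F P != set0)) /=.
rewrite [X in _ :|: X]big1 ?setU0; last by move=> P /andP[_ /negbNE/eqP].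
apply: (@leq_trans (\sum_(P in monic_irr K d | short_multiples k h F P != set0)
   #|short_multiples k h F P|)).
  exact: card_bigcup_leq.
under [X in (_ <= X)%N]eq_bigl do rewrite inE.
by apply: leq_sum => P /andP[/monic_irrP[_ sP _] _]; apply: card_short_multiples.
Qed.

(** A non-constant [D] has a monic irreducible factor [P], and [P ^+ k] dividing a polynomial of
    degree [n] forces [k * deg P <= n]. *)
Lemma k_free_shift k h n (F : {poly K}) (E : {poly_(h.+1) K}) : (0 < k)%N ->
  size (F + E) = n.+1 ->
  (forall d, (0 < d)%N -> (k * d <= n)%N -> E \notin bad_shifts k h F d) ->
  k_free k (F + E).
Proof.
move=> k_gt0 sFE good D D_gt1; apply/negP => dvdD.
have [P [mP iP dP]] := exists_monic_irr_dvdp D_gt1.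
have [P_gt1 _] := iP.
pose d := (size P).-1; have sP : size P = d.+1 by rewrite /d prednK // ltnW.
have dvdP : P ^+ k %| F + E by apply: dvdp_trans dvdD; apply: dvdp_exp2r.
have d_gt0 : (0 < d)%N by rewrite -ltnS -sP.
have FE0 : F + E != 0 by rewrite -size_poly_eq0 sFE.
have le_kdn : (k * d <= n)%N.
  by have := dvdp_leq FE0 dvdP; rewrite sFE (size_expS _ sP) mulnC.
have /negP := good d d_gt0 le_kdn; apply.
have PE : npolyp d.+1 P = P :> {poly K} by rewrite npolypK // sP.
apply/bigcupP; exists (npolyp d.+1 P); last by rewrite inE PE.
by apply/monic_irrP; rewrite PE.
Qed.

Lemma exists_k_free_shift r n h (F : {poly K}) :
  let k := r.+2 in let M := k.*2.-1 in let T := (M * M.*2.+1)%N in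
  pade_coef K k 0 != 0 -> pade_coef K k 1 != 0 ->
  (2 < q)%N -> (2 < k)%N -> size F = n.+1 -> (h < n)%N ->
  (n <= k.*2 * h)%N -> (k * q ^ T <= h)%N ->
  exists E : {poly_(h.+1) K}, k_free k (F + E).
Proof.
move=> k M T c0 c1 q_gt2 k_gt2 sF lt_hn le_nkh le_h.
have irr_le d : (0 < d)%N -> (#|monic_irr K d| <= q ^ d)%N.
  by move=> d_gt0; apply: leq_trans (card_monic_irr K d_gt0); rewrite leq_pmull.
have sub_irr d : (#|[set P in monic_irr K d | short_multiples k h F P != set0]|
                  <= #|monic_irr K d|)%N.
  by apply/subset_leq_card/subsetP => P; rewrite inE => /andP[].
have lt_sum : (\sum_(1 <= d < h.*2.+1) #|bad_shifts k h F d| < q ^ h.+1)%N.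
  apply: (@sum_three_ranges_lt q (ltnW q_gt2) k) => //.
  - move=> d d_gt0; apply: leq_trans (card_bad_shifts k h F d) _.
    by rewrite leq_mul2r (leq_trans (sub_irr d)) ?irr_le ?orbT.
  - move=> d lt_hkd; have d_gt0 : (0 < d)%N.
      by case: d lt_hkd => //; rewrite muln0.
    apply: leq_trans (card_monic_irr K d_gt0); rewrite leq_mul2l.
    rewrite (leq_trans (card_bad_shifts k h F d)) ?orbT //.
    by move: lt_hkd; rewrite -subn_eq0 => /eqP->; rewrite muln1.
  move=> t /andP[t_gt0 le_th]; set d := (h + t)%N.
  have M_gt0 : (0 < M)%N by [].
  have tM : (M * (t %/ M) <= t)%N by rewrite mulnC leq_trunc_div.
  have le_tM : (t %/ M <= t)%N by apply: leq_div.
  have lt_hd : (h < d)%N by rewrite /d; lia.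
  apply: leq_trans (card_bad_shifts k h F d) _.
  have -> : (h.+1 - k * d = 0)%N.
    by apply/eqP; rewrite subn_eq0 (leq_trans lt_hd) // leq_pmull.
  rewrite muln1; have s_gt0 : (0 < t + t %/ M)%N by rewrite addn_gt0 t_gt0.
  (* The closeness parameter is [s = t + t %/ M - 1]. Then [M * s <= (M + 1) * t - M], so with
     [n <= (M + 1) * h] the requirement [n + M * s < (M + 1) * d] holds. *)
  have -> : (h - t %/ M = d - (t + t %/ M).-1.+1)%N by rewrite prednK // /d (addnC h) subnDl.
  apply: (card_large_irr c0 c1 sF) => //.
    by rewrite prednK // addnC leq_add2r (leq_trans le_tM).
  have ME : r.+1.*2.+1 = M by [].
  have kE : r.+2.*2 = M.+1 by [].
  have : (M * (t + t %/ M).-1 + M = M * (t + t %/ M))%N by rewrite -mulnSr prednK.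
  move: le_nkh M_gt0 tM; rewrite ME kE /d; clearbody M; clear.
  rewrite !mulnDr !mulSn; move: (t %/ M)%N => x.
  by move: (M * _.-1)%N (M * t)%N (M * h)%N (M * x)%N => *; lia.
(* Degrees up to [2h] suffice, since [k * d <= n <= 2k * h]. *)
pose U := \bigcup_(d < h.*2.+1 | (0 < d)%N) bad_shifts k h F d.
have lt_card : (#|U| < #|{: {poly_(h.+1) K}}|)%N.
  rewrite card_npoly; apply: leq_ltn_trans lt_sum.
  apply: leq_trans (card_bigcup_leq _ _) _.
  rewrite -(big_mkord (fun d => 0 < d)%N (fun d => #|bad_shifts k h F d|)).
  rewrite big_ltn_cond //= big_nat_cond [X in (_ <= X)%N]big_nat.
  by rewrite (eq_bigl (fun d => 1 <= d < h.*2.+1)%N) // => d; case: d => //= d; rewrite andbT.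
have [E Egood] : exists E, E \notin U.
  apply/existsP; rewrite -negb_forall; apply: contraTN lt_card => /forallP allE.
  by rewrite -leqNgt; apply/subset_leq_card/subsetP => E _; apply: allE.
exists E; apply: (k_free_shift (n := n)) => // [|d d_gt0 le_kdn].
  by rewrite size_polyDl sF // (leq_ltn_trans (size_npoly _)).
have lt_dh : (d < h.*2.+1)%N.
  rewrite ltnS -(leq_pmul2l (_ : 0 < k)%N) // (leq_trans le_kdn) //.
  by rewrite (leq_trans le_nkh) // -!muln2 mulnAC mulnA.
by apply: contra Egood => Ebad; apply/bigcupP; exists (Ordinal lt_dh).
Qed.
End KFreeShifts.

(** * Choice of the threshold and passage to integer [h] *)

Theorem theorem1p5 (k : nat) (K : finFieldType) (p : nat)
    (hk : (3 <= k)%N) (hq : (3 <= #|K|)%N)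
    (hp : p \in [pchar K])
    (hpk : ~~ (p %| k * 'C(2 * k - 1, k - 1))%N) :
  exists N : nat, forall n : nat, (N <= n)%N ->
    forall F : {poly K}, F \is monic -> size F = n.+1 ->
    forall h : int, n%:R / (2 * k)%:R <= h%:~R :> rat ->
    exists Q : {poly K}, Q \in poly_interval F h /\ k_free k Q.
Proof.
case: k hk hpk => [|[|r]] // hk hpk.
have [c0 c1] : pade_coef K r.+2 0 != 0 /\ pade_coef K r.+2 1 != 0.
  apply: pade_coef_neq0 hp _.
  by have -> : (r.*2.+3 = 2 * r.+2 - 1)%N by lia; rewrite -subSS subn0 in hpk *.
pose M := r.+2.*2.-1; pose T := (M * M.*2.+1)%N.
(* With [W = k * q ^ T], the threshold [2k(W + 1)] and [h >= n / (2k)] give [h > W], the size of [h]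
   required by the middle range. *)
exists (r.+2.*2 * (r.+2 * #|K| ^ T).+1)%N => n le_Nn F _ sF h le_nh.
have le_nkh : (n%:Z <= r.+2.*2%:Z * h).
  move: le_nh; rewrite ler_pdivrMr ?ltr0n // mulrC mul2n.
  by rewrite !pmulrn -intrM ler_int.
have [h' hE] : exists h' : nat, h = h'.
  by case: h le_nkh {le_nh} => h'; [exists h' | lia].
rewrite hE in le_nkh *.
have le_nkh' : (n <= r.+2.*2 * h')%N by lia.
(* Capping at [n - 1] keeps [F + E] of degree [n]; the smaller interval lies in the given one. *)
pose h0 := minn h' n.-1; set W := (r.+2 * #|K| ^ T)%N in le_Nn.
have lt_Wh : (W < h')%N.
  by rewrite -(@leq_pmul2l r.+2.*2) // (leq_trans le_Nn).
have lt_Wn : (W.*2.+1 < n)%N.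
  apply: leq_trans le_Nn; rewrite -doubleS -mul2n leq_mul2r.
  by rewrite -addnn leq_addr orbT.
have [|||E freeE] := @exists_k_free_shift K r n h0 F c0 c1 hq hk sF.
- by rewrite gtn_min orbC prednK ?leqnn //; lia.
- rewrite /h0 /minn; case: ifP => // _.
  by apply: leq_trans (leq_mul (_ : 2 <= r.+2.*2)%N (leqnn _)); lia.
- by rewrite leq_min -/T -/W (ltnW lt_Wh); lia.
exists (F + E); split=> //.
rewrite inE opprD addNKr oppr_eq0 size_polyN.
have [//|E0] := eqVneq; rewrite /= lez_nat.
apply: leq_trans (geq_minl h' n.-1).
by rewrite -subn1 leq_subLR add1n size_npoly.
Qed.
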